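(* Every ideal in $\mathcal{B}$ is isomorphic to either $P_\alpha$, $Q_\alpha$ or $P_\alpha\oplus Q_\alpha$ for some $\alpha<\omega_1$.
   Context: An ideal over a countable set $X$ is a family of subsets of $X$ that contains every finite subset of $X$ and is closed under taking subsets and finite unions ($\mathcal{P}(X)$ is allowed). Two ideals $I$ on $X$ and $J$ on $Y$ are isomorphic ($I\cong J$) if there is a bijection $f:X\to Y$ such that $A\in I$ iff $f[A]\in J$. The orthogonal of $I$ is $I^\perp=\{B\subseteq X: A\cap B\text{ is finite for all }A\in I\}$. Direct sum: given finitely or countably many ideals $I_n$ on countably infinite sets $X_n$, take a partition $\{K_n\}$ of $\mathbb{N}$ and an isomorphic copy $I_n'$ of $I_n$ on $K_n$; then $A\in\bigoplus_n I_n$ iff $A\cap K_n\in I_n'$ for all $n$ (well defined up to isomorphism); $I^\omega$ denotes $\bigoplus_{n\in\mathbb{N}} I$. $\mathcal{B}$ is the smallest collection of ideals on $\mathbb{N}$ (regarded as closed under isomorphism) containing the ideal $\mathrm{FIN}$ of finite sets and closed under countable (including finite) direct sums and orthogonal. For every limit ordinal $\alpha<\omega_1$ fix an increasing sequence $(\upsilon_n^\alpha)_n$ of ordinals below $\alpha$ with $\sup_n\upsilon_n^\alpha=\alpha$. Define by recursion: $P_0=\mathcal{P}(\mathbb{N})$; $P_{\alpha+1}=(P_\alpha^\perp)^\omega$; $P_\alpha=\bigoplus_n P_{\upsilon_n^\alpha}^\perp$ for $\alpha<\omega_1$ a limit ordinal; and $Q_\alpha=P_\alpha^\perp$ for every $\alpha<\omega_1$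 (so $Q_0=\mathrm{FIN}$). *)

(* Defs.v *)
From HB Require Import structures.
From mathcomp Require Import all_boot all_order.
From mathcomp Require Import boolp classical_sets functions cardinality.
From Stdlib Require Cantor.

Set Implicit Arguments.
Unset Strict Implicit.
Unset Printing Implicit Defensive.

Import Order.TTheory.

Local Open Scope classical_set_scope.
Local Open Scope order_scope.

Local Obligation Tactic := idtac.

Record ideal (X : countType) := Ideal {
  ideal_sets :> set X -> Prop;
  ideal_fin : forall A, finite_set A -> ideal_sets A;
  ideal_sub : forall A B, A `<=` B -> ideal_sets B -> ideal_sets A;
  ideal_setU : forall A B, ideal_sets A -> ideal_sets B -> ideal_sets (A `|` B)
}.

Definition ideal_iso (X Y : countType) (I : ideal X) (J : ideal Y) : Prop :=
  exists f : X -> Y, bijective f /\ forall A, I A <-> J (f @` A).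

Notation "I ≅ J" := (ideal_iso I J) (at level 70, no associativity).

Program Definition FIN (X : countType) : ideal X :=
  @Ideal X [set A | finite_set A] _ _ _.
Next Obligation. by []. Qed.
Next Obligation. by move=> X A B AB /= /(sub_finite_set AB). Qed.
Next Obligation. by move=> X A B /= fA fB; rewrite finite_setU. Qed.

Program Definition powerset_ideal (X : countType) : ideal X :=
  @Ideal X setT _ _ _.
Next Obligation. by []. Qed.
Next Obligation. by []. Qed.
Next Obligation. by []. Qed.

Program Definition orthogonal (X : countType) (I : ideal X) : ideal X :=
  @Ideal X [set B | forall A, I A -> finite_set (A `&` B)] _ _ _.
Next Obligation.
by move=> X I B fB A _; apply: sub_finite_set fB; apply: subIsetr.
Qed.
Next Obligation.
by move=> X I B C BC /= hC A /hC; apply: sub_finite_set; apply: setIS.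
Qed.
Next Obligation.
move=> X I B C /= hB hC A IA; rewrite setIUr finite_setU.
by split; [exact: hB|exact: hC].
Qed.

Notation "I ^⊥" := (orthogonal I) (at level 2, left associativity, format "I ^⊥").

Lemma finite_preimage_inj (X Y : Type) (f : X -> Y) (B : set Y) :
  injective f -> finite_set B -> finite_set (f @^-1` B).
Proof.
by move=> injf; apply: finite_preimage => x y _ _; exact: injf.
Qed.

Lemma existT_inj (N : countType) (X : N -> countType) (n : N) :
  injective (existT (fun i => X i : Type) n).
Proof. by move=> x y /eqP; rewrite eq_Tagged => /eqP. Qed.

(* The direct sum lives on the disjoint union of the underlying sets, the
   blocks K_n being the fibres {n} x X_n. *)
Program Definition dsum (N : countType) (X : N -> countType)
    (I : forall n, ideal (X n)) : ideal {n : N & X n} :=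
  @Ideal {n : N & X n}
    [set A | forall n, I n (existT (fun i => X i : Type) n @^-1` A)] _ _ _.
Next Obligation.
move=> N X I A fA n; apply: ideal_fin.
by apply: finite_preimage_inj => //; apply: existT_inj.
Qed.
Next Obligation.
by move=> N X I A B AB /= hB n; apply: ideal_sub (hB n) => x; apply: AB.
Qed.
Next Obligation. by move=> N X I A B /= hA hB n; apply: ideal_setU. Qed.

Definition dsum2 (X : countType) (I J : ideal X) : ideal {_ : bool & X} :=
  dsum (fun b : bool => if b then I else J).

Notation "I ⊕ J" := (dsum2 I J) (at level 50, left associativity).

(* The class ℬ, as a class of ideals on ℕ closed under isomorphism. A finite
   index type N gives the finite direct sums; N is automatically nonempty since
   J is an ideal on ℕ. *)
Inductive inB : ideal nat -> Prop :=
| inB_FIN : inB (FIN nat)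
| inB_iso (I J : ideal nat) : I ≅ J -> inB I -> inB J
| inB_orthogonal (I : ideal nat) : inB I -> inB I^⊥
| inB_dsum (N : countType) (I : N -> ideal nat) (J : ideal nat) :
    (forall n, inB (I n)) -> J ≅ dsum I -> inB J.

Program Definition pushforward (X Y : countType) (f : X -> Y)
    (injf : injective f) (I : ideal X) : ideal Y :=
  @Ideal Y [set B | I (f @^-1` B)] _ _ _.
Next Obligation.
by move=> X Y f injf I B fB; apply: ideal_fin; apply: finite_preimage_inj.
Qed.
Next Obligation.
by move=> X Y f injf I B C BC /=; apply: ideal_sub => x; apply: BC.
Qed.
Next Obligation. by move=> X Y f injf I B C /=; apply: ideal_setU. Qed.

Definition nat_pairing (p : {_ : nat & nat}) : nat :=
  Cantor.to_nat (tag p, tagged p).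

Lemma nat_pairing_bij : bijective nat_pairing.
Proof.
exists (fun n => existT (fun _ => nat) (Cantor.of_nat n).1 (Cantor.of_nat n).2).
  by case=> n m; rewrite /nat_pairing Cantor.cancel_of_to.
by move=> n; rewrite /nat_pairing /=;
  case: (Cantor.of_nat n) (Cantor.cancel_to_of n).
Qed.

(* An isomorphic copy on ℕ of a countably infinite direct sum of ideals on ℕ;
   the blocks of the partition of ℕ are given by Cantor's pairing function. *)
Definition nat_dsum (I : nat -> ideal nat) : ideal nat :=
  pushforward (bij_inj nat_pairing_bij) (dsum I).

Lemma nat_dsum_iso (I : nat -> ideal nat) : dsum I ≅ nat_dsum I.
Proof.
exists nat_pairing; split; first exact: nat_pairing_bij.
move=> A /=; suff -> : nat_pairing @^-1` (nat_pairing @` A) = A by [].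
apply/seteqP; split => x /=; last by move=> Ax; exists x.
by move=> [y Ay /(bij_inj nat_pairing_bij) <-].
Qed.

Definition omega (I : ideal nat) : ideal nat := nat_dsum (fun _ => I).

Notation "I ^ω" := (omega I) (at level 2, left associativity, format "I ^ω").

(* W is (order isomorphic to) the set of countable ordinals: an uncountable
   well-order all of whose proper initial segments are countable. *)
Record is_omega1 (d : Order.disp_t) (W : orderType d) : Prop := IsOmega1 {
  omega1_wf : well_founded (fun a b : W => a < b);
  omega1_countable : forall a : W, countable [set b | b < a];
  omega1_uncountable : ~ countable [set: W]
}.

Section Ordinals.
Context (d : Order.disp_t) (W : orderType d).

Definition is_zero (a : W) : Prop := forall b, a <= b.

Definition is_succ (b a : W) : Prop := b < a /\ forall c, b < c -> a <= c.

Definition is_limit (a : W) : Prop := ~ is_zero a /\ ~ exists b, is_succ b a.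

Definition fundamental_sequences (v : W -> nat -> W) : Prop :=
  forall a, is_limit a ->
    [/\ {homo v a : m n / (m < n)%N >-> m < n},
        forall n, v a n < a
      & supremums (range (v a)) a].

Variables (hW : is_omega1 W) (v : W -> nat -> W).

(* The local P is the recursive call; its default value is never reached when
   the sequences satisfy fundamental_sequences. See P_zero, P_succ and P_limit
   below for the resulting recursion equations. *)
Definition P_step (a : W) (rec : forall b, b < a -> ideal nat) : ideal nat :=
  let P b := if pselect (b < a) is left h then rec b h
             else powerset_ideal nat in
  if pselect (exists b, is_succ b a) is left e then ((P (projT1 (cid e)))^⊥)^ω
  else if pselect (is_zero a) then powerset_ideal nat
  else nat_dsum (fun n => (P (v a n))^⊥).

Definition P : W -> ideal nat := Fix (omega1_wf hW) (fun _ => ideal nat) P_step.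

Definition Q (a : W) : ideal nat := (P a)^⊥.

Lemma PE a : P a = P_step (fun b (_ : b < a) => P b).
Proof.
rewrite /P Fix_eq // => x f g fg; congr P_step.
by apply: functional_extensionality_dep => y;
  apply: functional_extensionality_dep => h; apply: fg.
Qed.

Lemma P_zero a : is_zero a -> P a = powerset_ideal nat.
Proof.
move=> a0; rewrite PE /P_step; case: pselect => [e|ne].
  by exfalso; have [b [ba _]] := e; move: (a0 b); rewrite leNgt ba.
by case: pselect.
Qed.

Lemma P_succ b a : is_succ b a -> P a = ((P b)^⊥)^ω.
Proof.
move=> ba; rewrite PE /P_step; case: pselect => [e|]; last by case; exists b.
case: (cid e) => c [ca hc] /=; case: ba => ba hb.
case: pselect => // _; suff -> : c = b by [].
apply/eqP; rewrite eq_le !leNgt; apply/andP; split; apply/negP.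
  by move/hb; rewrite leNgt ca.
by move/hc; rewrite leNgt ba.
Qed.

Lemma P_limit a : fundamental_sequences v -> is_limit a ->
  P a = nat_dsum (fun n => (P (v a n))^⊥).
Proof.
move=> hv la; have [_ va _] := hv _ la; case: la => a0 aS.
rewrite PE /P_step; case: pselect => [e|ne]; first by case: (aS e).
case: (pselect (is_zero a)) => [z|nz]; first by case: (a0 z).
by congr nat_dsum; apply: funext => n;
  case: (pselect (v a n < a)) => [//|nva]; case: (nva (va n)).
Qed.

End Ordinals.

(* Main.v *)
(* Say that I absorbs J if I ⊕ J ≅ I. Each nonzero P_a is a direct sum of ideals
   Q_c with c < a cofinal below a, so by well-founded induction P_a absorbs P_b
   for b <= a and Q_b for b < a, hence also countable sums of these; orthogonality
   transfers the binary absorptions to Q_a. A countable sum of P's and Q's is then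
   determined by the least strict upper bound a of the ranks. If a is a limit, or
   if a = c + 1 and Q_c occurs infinitely often, the sum is P_a. Otherwise the
   finitely many copies of Q_c collapse to one, and the rest is P_c, if P_c occurs,
   or a sum of smaller rank, handled by induction. Ideals that absorb each other
   are isomorphic, so no Cantor-Bernstein argument is needed. *)
Require Import Defs.
From mathcomp Require Import all_boot all_order.
From mathcomp Require Import boolp classical_sets functions cardinality.
From Stdlib Require Cantor.

Set Implicit Arguments.
Unset Strict Implicit.
Unset Printing Implicit Defensive.

Import Order.TTheory.

Local Open Scope classical_set_scope.
Local Open Scope order_scope.

Local Obligation Tactic := idtac.

(** * Isomorphism of ideals *)

(** Preimages, unlike images, commute with the set operations by conversion, so most isomorphisms
    below are built and used through them. *)
Lemma iso_of_preimage (X Y : countType) (I : ideal X) (J : ideal Y)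
    (f : X -> Y) :
  injective f -> (forall y, exists x, f x = y) ->
  (forall B, J B <-> I (f @^-1` B)) -> I ≅ J.
Proof.
move=> finj /choice[g fg] IJ; exists f; split.
  by exists g => // x; apply: finj; rewrite fg.
move=> A; rewrite IJ; suff -> : f @^-1` (f @` A) = A by [].
apply/seteqP; split => x /=; last by exists x.
by move=> [y Ay /finj <-].
Qed.

Lemma iso_preimage (X Y : countType) (I : ideal X) (J : ideal Y) :
  I ≅ J -> exists f : X -> Y, exists g : Y -> X,
    [/\ cancel f g, cancel g f & forall B, J B <-> I (f @^-1` B)].
Proof.
move=> [f [[g fK gK] IJ]]; exists f, g; split=> // B; rewrite IJ.
suff -> : f @` (f @^-1` B) = B by [].
apply/seteqP; split => y /=; first by move=> [x Bfx <-].
by move=> By; exists (g y); rewrite ?gK.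
Qed.

Lemma iso_refl (X : countType) (I : ideal X) : I ≅ I.
Proof. by apply: (@iso_of_preimage _ _ _ _ id) => // y; exists y. Qed.

Lemma iso_sym (X Y : countType) (I : ideal X) (J : ideal Y) : I ≅ J -> J ≅ I.
Proof.
move=> /iso_preimage[f [g [fK gK IJ]]]; apply: (@iso_of_preimage _ _ _ _ g).
- exact: can_inj gK.
- by move=> x; exists (f x).
- move=> B; rewrite IJ; suff -> : f @^-1` (g @^-1` B) = B by [].
  by apply/seteqP; split => x /=; rewrite fK.
Qed.

Lemma iso_trans (X Y Z : countType) (I : ideal X) (J : ideal Y) (K : ideal Z) :
  I ≅ J -> J ≅ K -> I ≅ K.
Proof.
move=> /iso_preimage[f [g [fK gK IJ]]] /iso_preimage[h [k [hK kK JK]]].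
apply: (@iso_of_preimage _ _ _ _ (h \o f)).
- exact: inj_comp (can_inj hK) (can_inj fK).
- by move=> z; exists (g (k z)); rewrite /= gK kK.
- by move=> B; rewrite JK IJ.
Qed.

Lemma iso_orthogonal (X Y : countType) (I : ideal X) (J : ideal Y) :
  I ≅ J -> I^⊥ ≅ J^⊥.
Proof.
move=> /iso_preimage[f [g [fK gK IJ]]]; apply: (@iso_of_preimage _ _ _ _ f).
- exact: can_inj fK.
- by move=> y; exists (g y).
move=> B; split=> /= hB A.
  move=> IA; have /hB fAB : J (g @^-1` A).
    by rewrite IJ; apply: ideal_sub IA => x /=; rewrite fK.
  have := finite_preimage_inj (can_inj fK) fAB.
  by apply: sub_finite_set => x [Ax Bx]; split=> //=; rewrite fK.
rewrite IJ => /hB fAB; have := finite_preimage_inj (can_inj gK) fAB.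
by apply: sub_finite_set => y [Ay By]; split; rewrite /= gK.
Qed.

(** * Binary and countable direct sums *)

(** Unlike [⊕], this sum allows different carriers, so that sums nest and reassociate; [dsum2_iso]
    links the two. *)
Program Definition sum_ideal (X Y : countType) (I : ideal X) (J : ideal Y) :
    ideal (X + Y)%type :=
  @Ideal (X + Y)%type [set A | I (inl @^-1` A) /\ J (inr @^-1` A)] _ _ _.
Next Obligation.
move=> X Y I J A fA; split; apply: ideal_fin;
  by apply: finite_preimage_inj => // x y [].
Qed.
Next Obligation.
move=> X Y I J A B AB /= [IB JB].
by split; [apply: ideal_sub IB|apply: ideal_sub JB] => x; apply: AB.
Qed.
Next Obligation.
by move=> X Y I J A B /= [IA JA] [IB JB]; split; apply: ideal_setU.
Qed.

Notation "I ⊞ J" := (sum_ideal I J) (at level 50, left associativity).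

Lemma sum_iso (X X' Y Y' : countType) (I : ideal X) (I' : ideal X')
    (J : ideal Y) (J' : ideal Y') :
  I ≅ I' -> J ≅ J' -> I ⊞ J ≅ I' ⊞ J'.
Proof.
move=> /iso_preimage[f [g [fK gK II]]] /iso_preimage[h [k [hK kK JJ]]].
apply: (@iso_of_preimage _ _ _ _
  (fun z => match z with inl x => inl (f x) | inr y => inr (h y) end)).
- by move=> [x|y] [x'|y'] // [] => [/(can_inj fK)|/(can_inj hK)] ->.
- by move=> [x|y]; [exists (inl (g x)); rewrite gK|exists (inr (k y)); rewrite kK].
- by move=> B /=; rewrite II JJ.
Qed.

Lemma sum_isoC (X Y : countType) (I : ideal X) (J : ideal Y) : I ⊞ J ≅ J ⊞ I.
Proof.
apply: (@iso_of_preimage _ _ _ _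
  (fun z => match z with inl x => inr x | inr y => inl y end)).
- by move=> [x|y] [x'|y'] // [] ->.
- by move=> [x|y]; [exists (inr x)|exists (inl y)].
- by move=> B; split=> - [? ?]; split.
Qed.

Lemma sum_isoA (X Y Z : countType) (I : ideal X) (J : ideal Y) (K : ideal Z) :
  I ⊞ (J ⊞ K) ≅ (I ⊞ J) ⊞ K.
Proof.
apply: (@iso_of_preimage _ _ _ _ (fun z => match z with
  | inl x => inl (inl x) | inr (inl y) => inl (inr y) | inr (inr z) => inr z
  end)).
- by move=> [x|[y|z]] [x'|[y'|z']] // [] ->.
- by move=> [[x|y]|z]; [exists (inl x)|exists (inr (inl y))|exists (inr (inr z))].
- by move=> B; split=> [[[? ?] ?]|[? [? ?]]].
Qed.

Lemma finite_set_sum (X Y : Type) (A : set (X + Y)) :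
  finite_set (inl @^-1` A) -> finite_set (inr @^-1` A) -> finite_set A.
Proof.
move=> fl fr; apply: (@sub_finite_set _ _
  (inl @` (inl @^-1` A) `|` inr @` (inr @^-1` A))).
  by move=> [x|y] Az; [left; exists x|right; exists y].
by rewrite finite_setU; split; apply: finite_image.
Qed.

(** Sets lying in one summand are enough as tests, because their trace on the other summand is
    empty. *)
Lemma sum_orthogonal (X Y : countType) (I : ideal X) (J : ideal Y) :
  (I ⊞ J)^⊥ ≅ I^⊥ ⊞ J^⊥.
Proof.
apply: (@iso_of_preimage _ _ _ _ id) => // [y|B]; first by exists y.
split=> [[/= hI hJ] A [IA JA]|/= hB].
  by apply: finite_set_sum; [apply: hI|apply: hJ].
split=> A hA.
  have /hB : (I ⊞ J) (inl @` A).
    split=> /=.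
      by apply: ideal_sub hA => x [x' Ax' [<-]].
    by apply: ideal_fin; apply: (sub_finite_set _ (finite_set0 _)) => y [].
  have linj : injective (@inl X Y) by move=> ? ? [].
  move=> /(finite_preimage_inj linj); apply: sub_finite_set => x [Ax Bx].
  by split=> //=; exists x.
have /hB : (I ⊞ J) (inr @` A).
  split=> /=.
    by apply: ideal_fin; apply: (sub_finite_set _ (finite_set0 _)) => y [].
  by apply: ideal_sub hA => x [x' Ax' [<-]].
have rinj : injective (@inr X Y) by move=> ? ? [].
move=> /(finite_preimage_inj rinj); apply: sub_finite_set => x [Ax Bx].
by split=> //=; exists x.
Qed.

Lemma dsum_iso (N : countType) (X Y : N -> countType)
    (I : forall n, ideal (X n)) (J : forall n, ideal (Y n)) :
  (forall n, I n ≅ J n) -> dsum I ≅ dsum J.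
Proof.
move=> IJ; pose f n := projT1 (cid (iso_preimage (IJ n))).
have fP n := projT2 (cid (iso_preimage (IJ n))).
apply: (@iso_of_preimage _ _ _ _ (fun p : {n & X n} =>
  existT (fun n => Y n : Type) (tag p) (f (tag p) (tagged p)))).
- move=> [n x] [m y] /= e; have nm : n = m := congr1 (@projT1 _ _) e.
  case: _ / nm y e => y /existT_inj; have [g [fK _ _]] := fP n.
  by move=> /(can_inj fK) ->.
- move=> [n y]; have [g [_ gK _]] := fP n.
  by exists (existT _ n (g y)); rewrite /= /f gK.
- move=> B; split=> hB n; have [g [_ _ h]] := fP n.
    by have := hB n; rewrite h.
  by rewrite h; exact: hB.
Qed.

Lemma dsum_reindex (M N : countType) (h : M -> N) (X : N -> countType)
    (I : forall n, ideal (X n)) :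
  injective h -> (forall n, exists m, h m = n) ->
  dsum (fun m => I (h m)) ≅ dsum I.
Proof.
move=> hinj hsurj; apply: (@iso_of_preimage _ _ _ _
  (fun p : {m & X (h m)} => existT (fun n => X n : Type) (h (tag p)) (tagged p))).
- move=> [m x] [m' y] /= e; have /hinj mm : h m = h m' := congr1 (@projT1 _ _) e.
  by case: _ / mm y e => y /existT_inj ->.
- move=> [n y]; have [m e] := hsurj n; case: _ / e y => y.
  by exists (existT _ m y).
- move=> B; split=> hB n; first exact: hB.
  by have [m <-] := hsurj n; exact: hB.
Qed.

Lemma dsum_dsum (N : countType) (M : N -> countType)
    (X : forall n, M n -> countType) (I : forall n m, ideal (@X n m)) :
  dsum (fun n => dsum (I n)) ≅
  dsum (fun p : {n : N & M n} => I (tag p) (tagged p)).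
Proof.
apply: (@iso_of_preimage _ _ _ _ (fun p : {n & {m & @X n m}} =>
  existT (fun q : {n & M n} => @X (tag q) (tagged q) : Type)
    (existT _ (tag p) (tag (tagged p))) (tagged (tagged p)))).
- move=> [n [m x]] [n' [m' x']] /= e.
  have : existT (fun n => M n : Type) n m = existT _ n' m' := congr1 (@projT1 _ _) e.
  move=> e'; have nn : n = n' := congr1 (@projT1 _ _) e'.
  case: _ / nn m' x' e e' => m' x' e /existT_inj mm.
  by case: _ / mm x' e => x' /(@existT_inj _ (fun q : {n & M n} => @X (tag q) (tagged q))) ->.
- by move=> [[n m] x]; exists (existT _ n (existT _ m x)).
- move=> B; split=> [hB n m|hB [n m]]; first exact: (hB (existT _ n m)).
  exact: hB.
Qed.

Lemma dsum_sum (M N : countType) (X : (M + N)%type -> countType)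
    (I : forall z, ideal (X z)) :
  dsum (fun m => I (inl m)) ⊞ dsum (fun n => I (inr n)) ≅ dsum I.
Proof.
apply: (@iso_of_preimage _ _ _ _ (fun z => match z with
  | inl p => existT (fun z => X z : Type) (inl (tag p)) (tagged p)
  | inr p => existT (fun z => X z : Type) (inr (tag p)) (tagged p) end)).
- move=> [[m x]|[n x]] [[m' x']|[n' x']] /= e //.
  + have mm : m = m' by have := congr1 (@projT1 _ _) e => - [].
    by case: _ / mm x' e => x' /existT_inj ->.
  + have mm : n = n' by have := congr1 (@projT1 _ _) e => - [].
    by case: _ / mm x' e => x' /existT_inj ->.
- by move=> [[m|n] x]; [exists (inl (existT _ m x))|exists (inr (existT _ n x))].
- by move=> B; split=> [hB|[hl hr] [m|n]];
    [split=> n; exact: hB|exact: hl|exact: hr].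
Qed.

Lemma sum_dsum (N : countType) (X Y : N -> countType)
    (I : forall n, ideal (X n)) (J : forall n, ideal (Y n)) :
  dsum I ⊞ dsum J ≅ dsum (fun n => I n ⊞ J n).
Proof.
apply: (@iso_of_preimage _ _ _ _ (fun z => match z with
  | inl p => existT (fun n => (X n + Y n)%type) (tag p) (inl (tagged p))
  | inr p => existT (fun n => (X n + Y n)%type) (tag p) (inr (tagged p)) end)).
- move=> [[m x]|[n x]] [[m' x']|[n' x']] /= e;
    (have mm := congr1 (@projT1 _ _) e; simpl in mm; case: _ / mm x' e => x';
    by move=> /(@existT_inj _ (fun n => (X n + Y n)%type)) // [->]).
- by move=> [n [x|x]]; [exists (inl (existT _ n x))|exists (inr (existT _ n x))].
- move=> B; split=> [hB|[hl hr] n].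
    by split=> n; case: (hB n).
  by split; [exact: hl|exact: hr].
Qed.

Lemma dsum_unit (X : countType) (I : ideal X) : dsum (fun _ : unit => I) ≅ I.
Proof.
apply: (@iso_of_preimage _ _ _ _ (@projT2 unit (fun _ => X))).
- by move=> [[] x] [[] y] /= ->.
- by move=> x; exists (existT _ tt x).
- by move=> B; split=> [hB []|/(_ tt)].
Qed.

Lemma dsum_bool (X : countType) (I : bool -> ideal X) :
  dsum I ≅ I true ⊞ I false.
Proof.
apply: (@iso_of_preimage _ _ _ _ (fun p : {_ : bool & X} =>
  if tag p then inl (tagged p) else inr (tagged p))).
- by move=> [[] x] [[] y] //= [->].
- by move=> [x|x]; [exists (existT _ true x)|exists (existT _ false x)].
- by move=> B; split=> [[hl hr] []|hB] //.
Qed.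

Lemma dsum2_iso (X : countType) (I J : ideal X) : I ⊕ J ≅ I ⊞ J.
Proof. exact: dsum_bool. Qed.

(* Finiteness is essential: over an infinite index type, a set orthogonal to
   [dsum I] meets only finitely many blocks. *)
Lemma dsum_orthogonal (N : countType) (X : N -> countType)
    (I : forall n, ideal (X n)) :
  finite_set [set: N] -> (dsum I)^⊥ ≅ dsum (fun n => (I n)^⊥).
Proof.
move=> finN; apply: (@iso_of_preimage _ _ _ _ id) => // [y|B]; first by exists y.
split=> [hB A IA|/= hB n A IA].
  apply: (@sub_finite_set _ _ (\bigcup_(n in [set: N])
    (existT (fun n => X n : Type) n @` (existT _ n @^-1` (A `&` B))))).
    by move=> [n x] ABx; exists n => //; exists x.
  by apply: bigcup_finite => // n _; apply: finite_image; apply: hB (IA n).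
have /hB : dsum I (existT (fun n => X n : Type) n @` A).
  move=> m; have [<-|nm] := pselect (n = m).
    by apply: ideal_sub IA => x [y Ay /existT_inj <-].
  apply: ideal_fin; apply: (sub_finite_set _ (finite_set0 _)) => x [y _ e].
  by case: nm; exact: (congr1 (@projT1 _ _) e).
move=> /(finite_preimage_inj (@existT_inj N X n)).
by apply: sub_finite_set => x [Ax Bx]; split=> //=; exists x.
Qed.

(** * Absorption *)

Definition absorbs (X Y : countType) (I : ideal X) (J : ideal Y) : Prop :=
  I ⊞ J ≅ I.

Lemma absorbs_iso (X X' Y Y' : countType) (I : ideal X) (I' : ideal X')
    (J : ideal Y) (J' : ideal Y') :
  I ≅ I' -> J ≅ J' -> absorbs I J -> absorbs I' J'.
Proof.
move=> II JJ IJ; apply: iso_trans (iso_trans IJ II).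
by apply: sum_iso; apply: iso_sym.
Qed.

(** Both ideals are isomorphic to their common sum, which is commutative. *)
Lemma absorbs_anti (X Y : countType) (I : ideal X) (J : ideal Y) :
  absorbs I J -> absorbs J I -> I ≅ J.
Proof.
move=> IJ JI; apply: iso_trans JI; apply: iso_trans (sum_isoC _ _).
exact: iso_sym.
Qed.

Lemma absorbs_suml (X Y Z : countType) (I : ideal X) (J : ideal Y)
    (K : ideal Z) : absorbs J K -> absorbs (I ⊞ J) K.
Proof.
move=> JK; apply: iso_trans (sum_iso (iso_refl I) JK).
exact: iso_sym (sum_isoA _ _ _).
Qed.

Lemma absorbs_sumr (X Y Z : countType) (I : ideal X) (J : ideal Y)
    (K : ideal Z) : absorbs I J -> absorbs I K -> absorbs I (J ⊞ K).
Proof.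
move=> IJ IK; apply: iso_trans (sum_isoA _ _ _) _; apply: iso_trans IK.
by apply: sum_iso => //; exact: iso_refl.
Qed.

(** Orthogonals distribute over binary sums, so the direction of absorption is kept. *)
Lemma absorbs_orthogonal (X Y : countType) (I : ideal X) (J : ideal Y) :
  absorbs I J -> absorbs I^⊥ J^⊥.
Proof.
move=> IJ; apply: iso_trans (iso_orthogonal IJ).
exact: iso_sym (sum_orthogonal _ _).
Qed.

(* [N] is split into the range of [g], where the two sums are merged blockwise,
   and its complement. *)
Lemma absorbs_dsum (M N : countType) (g : M -> N) (X : N -> countType)
    (Y : M -> countType) (I : forall n, ideal (X n)) (J : forall m, ideal (Y m)) :
  injective g -> (forall m, absorbs (I (g m)) (J m)) ->
  absorbs (dsum I) (dsum J).
Proof.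
move=> ginj IJ; pose C := {n : N | n \notin range g}.
pose h (z : (M + C)%type) := match z with inl m => g m | inr c => val c end.
have hinj : injective h.
  move=> [m|c] [m'|c'] //=.
  - by move=> /ginj ->.
  - by move=> e; have /= := valP c'; rewrite -e notin_setE; case; exists m.
  - by move=> e; have /= := valP c; rewrite e notin_setE; case; exists m'.
  - by move=> /val_inj ->.
have hsurj n : exists z, h z = n.
  have [/set_mem[m _ <-]|nr] := boolP (n \in range g); first by exists (inl m).
  by exists (inr (exist _ n nr)).
have e := iso_trans (dsum_sum (fun z => I (h z))) (dsum_reindex I hinj hsurj).
apply: (absorbs_iso (iso_trans (sum_isoC _ _) e) (iso_refl _)).
apply: absorbs_suml; apply: iso_trans (sum_dsum _ _) _; exact: dsum_iso.
Qed.

Lemma absorbs_dsum1 (N : countType) (X : N -> countType) (Y : countType)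
    (I : forall n, ideal (X n)) (J : ideal Y) (n : N) :
  absorbs (I n) J -> absorbs (dsum I) J.
Proof.
move=> IJ; apply: (absorbs_iso (iso_refl _) (dsum_unit J)).
by apply: (@absorbs_dsum _ _ (fun _ => n)) => // - [] [].
Qed.

(** Serves when one class of a splitting of the index set is empty. *)
Lemma absorbs_dsum0 (M : countType) (X : countType) (Y : M -> countType)
    (I : ideal X) (J : forall m, ideal (Y m)) :
  (M -> False) -> absorbs I (dsum J).
Proof.
move=> M0; apply: (absorbs_iso (dsum_unit I) (iso_refl _)).
by apply: (@absorbs_dsum _ _ (fun _ => tt)) => m; case: (M0 m).
Qed.

(** * Powerset ideals, [FIN] and double orthogonals *)

Lemma dsum_powerset (N : countType) (X : N -> countType) :
  dsum (fun n => powerset_ideal (X n)) ≅ powerset_ideal {n : N & X n}.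
Proof. by apply: (@iso_of_preimage _ _ _ _ id) => // y; exists y. Qed.

Lemma powerset_iso (X Y : countType) (f : X -> Y) :
  bijective f -> powerset_ideal X ≅ powerset_ideal Y.
Proof. by exists f. Qed.

(** Shifting [nat] by one makes room at 0 for the extra point. *)
Lemma sum_nat_unit_iso (I : ideal (nat + unit)%type) (J : ideal nat) :
  (forall B, J B <-> I ((fun z => if z is inl n then n.+1 else 0%N) @^-1` B)) ->
  I ≅ J.
Proof.
move=> IJ; apply: iso_of_preimage IJ; first by move=> [x|[]] [y|[]] // [->].
by move=> [|n]; [exists (inr tt)|exists (inl n)].
Qed.

(** The blocks [X m] may be finite or empty, so the sum is broken into one-point ideals. The
    powerset ideal on [nat] is a sum of countably many copies of itself, and each point is absorbed
    by its own copy. *)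
Lemma absorbs_powerset_nat (M : countType) (X : M -> countType) :
  absorbs (powerset_ideal nat) (dsum (fun m => powerset_ideal (X m))).
Proof.
have P1 : absorbs (powerset_ideal nat) (powerset_ideal unit).
  by apply: sum_nat_unit_iso.
have Pnat : dsum (fun _ : nat => powerset_ideal nat) ≅ powerset_ideal nat.
  exact: iso_trans (dsum_powerset _) (powerset_iso nat_pairing_bij).
have e : dsum (fun _ : {m : M & X m} => powerset_ideal unit) ≅
    dsum (fun m => powerset_ideal (X m)).
  apply: iso_trans (iso_sym (dsum_powerset _)); apply: iso_trans (dsum_powerset _) _.
  apply: (@powerset_iso _ _ (fun p : {_ : {m & X m} & unit} => tag p)).
  by exists (fun p => existT (fun _ => unit) p tt) => // - [p []].
apply: (absorbs_iso Pnat e).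
by apply: (absorbs_dsum (g := pickle)) => //; exact: pcan_inj (@pickleK _).
Qed.

Lemma absorbs_FIN_point : absorbs (FIN nat) (powerset_ideal unit).
Proof.
apply: sum_nat_unit_iso => B; split=> [|[]] /= fB.
  by split=> //; apply: finite_preimage_inj fB => x y [].
move=> _; apply: (@sub_finite_set _ _ ([set 0%N] `|` succn @` [set n | B n.+1])).
  by move=> [|n] Bn; [left|right; exists n].
by rewrite finite_setU; split; [exact: finite_set1|exact: finite_image].
Qed.

(** A member of [I n], placed in block [n], is orthogonal to the whole sum. Testing against such
    sets already forces membership in each block, whatever the size of [N]. *)
Lemma iso_biorthogonal_dsum (N : countType) (X : N -> countType)
    (I : forall n, ideal (X n)) :
  (dsum (fun n => (I n)^⊥))^⊥^⊥ ≅ dsum (fun n => (I n)^⊥).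
Proof.
apply: (@iso_of_preimage _ _ _ _ id) => // [y|B]; first by exists y.
split=> [IB A hA|/= hB n A IA].
  by apply: sub_finite_set (hA _ IB) => x [].
have /hB : (dsum (fun n => (I n)^⊥))^⊥ (existT (fun n => X n : Type) n @` A).
  move=> C /(_ n) /= /(_ _ IA) fin.
  apply: sub_finite_set (finite_image (existT (fun n => X n : Type) n) fin).
  by move=> p [Cp [x Ax e]]; exists x => //; split=> //=; rewrite e.
move=> /(finite_preimage_inj (@existT_inj N X n)).
by apply: sub_finite_set => x [Ax Bx]; split=> //=; exists x.
Qed.

Lemma iso_biorthogonal_powerset (X : countType) :
  (powerset_ideal X)^⊥^⊥ ≅ powerset_ideal X.
Proof.
apply: (@iso_of_preimage _ _ _ _ id) => // [y|B]; first by exists y.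
by split=> // _ A /(_ setT I) /= fA; apply: sub_finite_set fA => x [].
Qed.

Lemma iso_orthogonal_powerset (X : countType) : (powerset_ideal X)^⊥ ≅ FIN X.
Proof.
apply: (@iso_of_preimage _ _ _ _ id) => // [y|B]; first by exists y.
split=> [fB A _|/= /(_ setT I)]; last by rewrite setTI.
by apply: sub_finite_set fB => x [].
Qed.

(** * Absorption among the ideals [P a] and [Q a] *)

Section Hierarchy.
Context (d : Order.disp_t) (W : orderType d) (hW : is_omega1 W).
Context (v : W -> nat -> W) (hv : fundamental_sequences v).

Local Notation P := (P hW v).
Local Notation Q := (Q hW v).

Lemma exists_zero : exists a : W, is_zero a.
Proof.
have a0 : W.
  have : [set: W] !=set0; last by move=> /cid[].
  apply/set0P/eqP => W0; case: hW => _ _; apply; rewrite W0; exact: countable0.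
elim/(well_founded_induction (omega1_wf hW)): a0 => a IH.
have [[b ba]|nob] := pselect (exists b, b < a); first exact: IH ba.
by exists a => b; rewrite leNgt; apply/negP => ba; apply: nob; exists b.
Qed.

(** Treats successors and limits at once: the ladder [c] is constant in the first case and cofinal
    in the second. Weak monotonicity is what both have in common. *)
Lemma P_ladder (a : W) : ~ is_zero a -> exists c : nat -> W,
  [/\ P a ≅ dsum (fun n => Q (c n)), forall n, c n < a,
      {homo c : m n / (m <= n)%N >-> m <= n}
    & (exists2 b, is_succ b a & forall n, c n = b) \/
      forall b, b < a -> exists n, b < c n].
Proof.
move=> a0; have [[b ba]|aS] := pselect (exists b, is_succ b a).
  exists (fun _ => b); split=> //; last by left; exists b.
  - by rewrite (P_succ hW v ba); exact: iso_sym (nat_dsum_iso _).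
  - by case: ba.
have la : is_limit a by split.
have [vm va [_ vsup]] := hv la.
exists (v a); split=> //.
- by rewrite (P_limit hW hv la); exact: iso_sym (nat_dsum_iso _).
- by move=> m n; rewrite leq_eqVlt => /predU1P[->//|/vm/ltW].
- right=> b ba; apply/not_existsP => /= ub.
  have : (a <= b)%O; last by rewrite leNgt ba.
  apply: vsup => _ [n _ <-]; rewrite leNgt; apply/negP; exact: ub.
Qed.

(** [P a] is a powerset ideal or a sum of orthogonals, and both kinds equal their double
    orthogonal. *)
Lemma Q_orthogonal (a : W) : (Q a)^⊥ ≅ P a.
Proof.
have [a0|/P_ladder[c [e _ _ _]]] := pselect (is_zero a).
  rewrite /Q (P_zero hW v a0); exact: iso_biorthogonal_powerset.
apply: iso_trans (iso_sym e); apply: iso_trans (iso_biorthogonal_dsum _).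
exact: iso_orthogonal (iso_orthogonal e).
Qed.

Lemma absorbs_P (a : W) : (forall b, b <= a -> absorbs (P a) (P b)) /\
  (forall b, b < a -> absorbs (P a) (Q b)).
Proof.
elim/(well_founded_induction (omega1_wf hW)): a => a IH.
have QQ c b : c < a -> b <= c -> absorbs (Q c) (Q b).
  by move=> /IH[+ _] => /[apply]; exact: absorbs_orthogonal.
have QP c b : c < a -> b < c -> absorbs (Q c) (P b).
  move=> /IH[_ +] => /[apply] /absorbs_orthogonal; apply: absorbs_iso.
    exact: iso_refl.
  exact: Q_orthogonal.
have [a0|] := pselect (is_zero a).
  split=> b ba; last by move: (a0 b); rewrite leNgt ba.
  have -> : b = a by apply/eqP; rewrite eq_le ba a0.
  rewrite (P_zero hW v a0); apply: absorbs_iso (absorbs_powerset_nat (fun _ => nat)).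
    exact: iso_refl.
  exact: dsum_unit.
move=> /P_ladder[c [e ca cm cof]].
(* Only weak cofinality is common to both cases: below a successor the ladder attains the
   predecessor but never exceeds it. *)
have cofl b : b < a -> exists n, b <= c n.
  case: cof => [[b' [b'a b'min] cb']|cof] ba; last first.
    by have [n /ltW] := cof b ba; exists n.
  exists 0%N; rewrite cb' leNgt; apply/negP => /b'min; by rewrite leNgt ba.
have Pe := absorbs_iso (iso_sym e).
split=> b; last first.
  move=> /cofl[n bcn]; apply: Pe (iso_refl _) _.
  by apply: (absorbs_dsum1 (n := n)); exact: QQ.
rewrite le_eqVlt => /predU1P[->|ba].
  apply: Pe (iso_sym e) _.
  by apply: (absorbs_dsum (g := id)) => // n; exact: QQ.
(* If some [c n] exceeds [b], a single block absorbs [P b]. The remaining case is that [b] is the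
   predecessor of [a], where every block is [Q b]; then [P b] is itself decomposed and absorbed
   block by block. *)
case: cof => [[b' ba' cb']|cof]; last first.
  have [n bcn] := cof b ba; apply: Pe (iso_refl _) _.
  by apply: (absorbs_dsum1 (n := n)); exact: QP.
have [n] := cofl b ba; rewrite le_eqVlt => /predU1P[bcn|bcn]; last first.
  apply: Pe (iso_refl _) _.
  by apply: (absorbs_dsum1 (n := n)); exact: QP.
(* For [b] zero there is no ladder: [P b] splits into single points, and each block [Q b], which is
   [FIN], absorbs one of them. *)
have [b0|/P_ladder[c' [e' cb _ _]]] := pselect (is_zero b).
  have -> : P b = powerset_ideal nat by exact: P_zero.
  have : bijective (tag : {_ : nat & unit} -> nat).
    by exists (fun n => existT _ n tt) => // - [m []].
  move=> /powerset_iso /(iso_trans (dsum_powerset _)) e'.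
  apply: Pe e' _; apply: (absorbs_dsum (g := id)) => // m.
  apply: absorbs_iso absorbs_FIN_point; last exact: iso_refl.
  rewrite cb' -(cb' n) -bcn /Q (P_zero hW v b0).
  exact: iso_sym (iso_orthogonal_powerset _).
apply: Pe (iso_sym e') _; apply: (absorbs_dsum (g := id)) => // m.
by rewrite cb' -(cb' n) -bcn; apply: QQ (ltW _).
Qed.

Lemma absorbs_Q_Q (a b : W) : b <= a -> absorbs (Q a) (Q b).
Proof. by move=> /(absorbs_P a).1; exact: absorbs_orthogonal. Qed.

Lemma absorbs_Q_P (a b : W) : b < a -> absorbs (Q a) (P b).
Proof.
move=> /(absorbs_P a).2/absorbs_orthogonal; apply: absorbs_iso.
  exact: iso_refl.
exact: Q_orthogonal.
Qed.

(** Block [k] of copy [j] goes to the block of [P a] numbered by the Cantor code of (j, k). This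
    code is at least [k], so by monotonicity of the ladder the target has at least the rank of the
    source. *)
Lemma absorbs_P_omega (a : W) (M : countType) :
  absorbs (P a) (dsum (fun _ : M => P a)).
Proof.
have [a0|/P_ladder[c [e ca cm _]]] := pselect (is_zero a).
  rewrite (P_zero hW v a0); exact: absorbs_powerset_nat.
have e' := iso_trans (iso_sym (dsum_dsum _)) (dsum_iso (fun _ : M => iso_sym e)).
apply: absorbs_iso (iso_sym e) e' _.
apply: (absorbs_dsum (g := fun p => Cantor.to_nat (pickle (tag p), tagged p))).
  move=> [j k] [j' k'] /(can_inj Cantor.cancel_of_to) /= [].
  by move=> /(pcan_inj (@pickleK _)) -> ->.
move=> [j k] /=; apply: absorbs_Q_Q; apply: cm.
apply/ssrnat.leP; apply: PeanoNat.Nat.le_trans (Cantor.to_nat_non_decreasing _ _).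
exact: PeanoNat.Nat.le_add_r.
Qed.

(** [P a] absorbs a sum of copies of itself, one for each summand, and copy [m] absorbs [J m]. *)
Lemma absorbs_P_dsum (a : W) (M : countType) (Y : M -> countType)
    (J : forall m, ideal (Y m)) :
  (forall m, absorbs (P a) (J m)) -> absorbs (P a) (dsum J).
Proof.
move=> PJ; apply: absorbs_iso (absorbs_P_omega a M) (iso_refl _) _.
by apply: absorbs_suml; apply: (absorbs_dsum (g := id)).
Qed.

Lemma P_finite_dsum (a : W) (M : countType) (m : M) :
  dsum (fun _ : M => P a) ≅ P a.
Proof.
apply: absorbs_anti (absorbs_P_omega a M).
by apply: (absorbs_dsum1 (n := m)); apply: (absorbs_P a).1.
Qed.

(** Dual to [P_finite_dsum], as orthogonality passes through a finite sum. An infinite sum behaves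
    differently, see [Q_infinite_dsum]. *)
Lemma Q_finite_dsum (a : W) (M : countType) (m : M) :
  finite_set [set: M] -> dsum (fun _ : M => Q a) ≅ Q a.
Proof.
move=> finM; apply: iso_trans (iso_orthogonal (P_finite_dsum a m)).
exact: iso_sym (dsum_orthogonal _ finM).
Qed.

(** The index sets [nat] and [M] inject into each other, so the two sums of copies of [Q b] absorb
    each other. *)
Lemma Q_infinite_dsum (a b : W) (M : countType) :
  is_succ b a -> infinite_set [set: M] -> dsum (fun _ : M => Q b) ≅ P a.
Proof.
move=> ba infM; rewrite (P_succ hW v ba).
apply: iso_trans (nat_dsum_iso _); apply: absorbs_anti.
  have /infiniteP/pcard_surjP[g gsurj] := infM.
  have /choice[h hK] n : exists m, g m = n by have [m _] := gsurj n I; exists m.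
  apply: (absorbs_dsum (g := h)); first exact: can_inj hK.
  by move=> _; exact: absorbs_Q_Q.
apply: (absorbs_dsum (g := pickle)); first exact: pcan_inj (@pickleK _).
by move=> _; exact: absorbs_Q_Q.
Qed.

(** * Countable sums of the ideals [P a] and [Q a] *)

Definition term (t : bool * W) : ideal nat := if t.1 then P t.2 else Q t.2.

Lemma absorbs_P_term (a : W) (t : bool * W) :
  t.2 < a -> absorbs (P a) (term t).
Proof.
by case: t => [[] b] ba; [apply: (absorbs_P a).1 (ltW ba)|apply: (absorbs_P a).2].
Qed.

Lemma term_absorbs_Q (t : bool * W) (b : W) : b < t.2 -> absorbs (term t) (Q b).
Proof.
case: t => [[] c] bc; first exact: (absorbs_P c).2.
exact: absorbs_Q_Q (ltW bc).
Qed.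

Definition normal_form (a : W) (X : countType) (I : ideal X) : Prop :=
  [\/ I ≅ P a, I ≅ Q a | I ≅ P a ⊞ Q a].

Definition normal_upto (a : W) (X : countType) (I : ideal X) : Prop :=
  I ≅ P a \/ exists2 b, b < a & normal_form b I.

Lemma normal_form_upto (a b : W) (X : countType) (I : ideal X) :
  b < a -> normal_upto b I -> normal_upto a I.
Proof.
move=> ba [IP|[c cb Ic]]; right; first by exists b => //; constructor 1.
by exists c => //; exact: lt_trans ba.
Qed.

(** [Q a] absorbs everything in normal form of smaller rank; only a summand [P a] survives next to
    it. *)
Lemma sum_Q_normal (a : W) (X : countType) (I : ideal X) :
  normal_upto a I -> normal_form a (Q a ⊞ I).
Proof.
case=> [IP|[b ba Ib]].
  constructor 3; apply: iso_trans (sum_isoC _ _) _.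
  exact: sum_iso IP (iso_refl _).
have QP := absorbs_Q_P ba; have QQ := absorbs_Q_Q (ltW ba).
constructor 2; case: Ib => e; apply: absorbs_iso (iso_refl _) (iso_sym e) _ => //.
exact: absorbs_sumr.
Qed.

Lemma dsum_split (N : countType) (p : pred N) (X : N -> countType)
    (I : forall n, ideal (X n)) :
  dsum I ≅ dsum (fun n : {n | p n} => I (val n)) ⊞
           dsum (fun n : {n | ~~ p n} => I (val n)).
Proof.
apply: iso_sym; pose h (z : ({n | p n} + {n | ~~ p n})%type) :=
  match z with inl n => val n | inr n => val n end.
apply: iso_trans (dsum_sum (fun z => I (h z))) _; apply: dsum_reindex.
  move=> [m|m] [n|n] //= => [/val_inj->//|e|e|/val_inj->//].
    by have /= := valP n; rewrite -e (valP m).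
  by have /= := valP m; rewrite e (valP n).
move=> n; have [pn|pn] := boolP (p n).
  by exists (inl (exist _ n pn)).
by exists (inr (exist _ n pn)).
Qed.

(** [P a] absorbs the sum term by term. Conversely the ladder of [P a] is injected into [N] so that
    each [Q (c k)] meets a term of larger rank. *)
Lemma limit_dsum (a : W) (N : countType) (t : N -> bool * W) :
  (forall b, is_succ b a -> False) -> ~ is_zero a ->
  (forall n, (t n).2 < a) -> (forall b, b < a -> exists n, b < (t n).2) ->
  dsum (fun n => term (t n)) ≅ P a.
Proof.
move=> aS a0 ta cof; apply: absorbs_anti; last first.
  by apply: absorbs_P_dsum => n; exact: absorbs_P_term.
have [c [e ca cm _]] := P_ladder a0; apply: absorbs_iso (iso_refl _) (iso_sym e) _.
have /choice[s sP] (b : W) : exists n, b < a -> b < (t n).2.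
  have [/cof[n bn]|ba] := pselect (b < a); first by exists n.
  (* For [b] not below [a] any index serves as default. *)
  by have [n _] := cof _ (ca 0%N); exists n.
(* Strictly increasing ranks make the chosen indices distinct. *)
pose g := fix g k := if k is k'.+1 then s (Order.max (c k) (t (g k')).2)
                     else s (c 0%N).
have maxa k : Order.max (c k.+1) (t (g k)).2 < a by rewrite gt_max ca ta.
have gmono : {homo (fun k => (t (g k)).2) : m n / (m < n)%N >-> m < n}.
  apply: homo_ltn => [x y z|k]; first exact: lt_trans.
  by have := sP _ (maxa k); rewrite gt_max => /andP[].
apply: (absorbs_dsum (g := g)) => [m n gmn|[|k]].
- by case: (ltngtP m n) => // /gmono; rewrite gmn ltxx.
- exact: term_absorbs_Q (sP _ (ca 0%N)).
- apply: term_absorbs_Q; have := sP _ (maxa k).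
  by rewrite gt_max => /andP[].
Qed.

Lemma dsum_normal_upto (a : W) (N : countType) (t : N -> bool * W) :
  inhabited N -> (forall n, (t n).2 < a) ->
  normal_upto a (dsum (fun n => term (t n))).
Proof.
elim/(well_founded_induction (omega1_wf hW)): a N t => a IH N t [n0] ta.
(* After this reduction [a] is the least strict upper bound of the ranks. *)
have [[b ba tb]|noub] := pselect (exists2 b, b < a & forall n, (t n).2 < b).
  by apply: normal_form_upto ba (IH b ba _ _ _ tb); constructor.
have cof b : b < a -> exists n, b <= (t n).2.
  move=> ba; apply/not_existsP => /= tb; apply: noub; exists b => // n.
  by rewrite ltNge; apply/negP; exact: tb.
have a0 : ~ is_zero a by move=> /(_ (t n0).2); rewrite leNgt ta.
have [[c [ca cmin]]|aS] := pselect (exists c, is_succ c a); last first.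
  left; apply: limit_dsum => // [b ba|b ba]; first by apply: aS; exists b.
  (* At a limit, an intermediate [b'] turns weak cofinality into strict cofinality. *)
  have [b' bb' b'a] : exists2 b', b < b' & b' < a.
    apply/not_exists2P => nb; apply: aS; exists b; split=> // b' bb'.
    by rewrite leNgt; apply/negP => b'a; case: (nb b').
  by have [n b'n] := cof b' b'a; exists n; exact: lt_le_trans b'n.
have tc n : (t n).2 <= c.
  by rewrite leNgt; apply/negP => /cmin; rewrite leNgt ta.
(* [A] collects the copies of [Q c], the only terms of rank at most [c] not known to be absorbed by
   [P c]; [B] is the rest. *)
pose isQ n := t n == (false, c).
pose A := dsum (fun n : {n | isQ n} => term (t (val n))).
pose B := dsum (fun n : {n | ~~ isQ n} => term (t (val n))).
have AQ : A ≅ dsum (fun n : {n | isQ n} => Q c).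
  by apply: dsum_iso => n; rewrite (eqP (valP n)); exact: iso_refl.
have BP n : ~~ isQ n -> absorbs (P c) (term (t n)).
  rewrite /isQ; have := tc n; case: (t n) => [[] b] /= bc.
    by move=> _; exact: (absorbs_P c).1.
  rewrite xpair_eqE eqxx /= => nbc; apply: (absorbs_P c).2.
  by rewrite lt_neqAle nbc.
suff : normal_upto a (A ⊞ B).
  have e := dsum_split isQ (fun n => term (t n)).
  case=> [e'|[b ba h]]; first by left; exact: iso_trans e'.
  right; exists b => //; case: h => e';
    [constructor 1|constructor 2|constructor 3]; exact: iso_trans e'.
have [finQ|infQ] := pselect (finite_set [set: {n | isQ n}]); last first.
  (* Infinitely many copies of [Q c] form [P a], which absorbs [B]. *)
  left; apply: iso_trans
    (sum_iso (iso_trans AQ (Q_infinite_dsum (conj ca cmin) infQ)) (iso_refl B)) _.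
  by apply: absorbs_P_dsum => n; exact: absorbs_P_term.
right; exists c => //.
have sumAB n : isQ n -> normal_upto c B -> normal_form c (A ⊞ B).
  move=> nQ /sum_Q_normal h.
  have e := sum_iso (iso_trans AQ (Q_finite_dsum c (exist _ n nQ) finQ)) (iso_refl B).
  by case: h => e';
    [constructor 1|constructor 2|constructor 3]; exact: iso_trans e'.
(* If [P c] occurs, it lies in [B] and absorbs all of it, so [B] is [P c]. Otherwise all ranks in
   [B] are below [c], and induction applies at [c]. *)
have [[n nP]|noP] := pselect (exists n, t n = (true, c)).
  have BPc : B ≅ P c.
    apply: absorbs_anti; last by apply: absorbs_P_dsum => m; exact: BP (valP m).
    have nQ : ~~ isQ n by rewrite /isQ nP.
    apply: (absorbs_dsum1 (n := exist _ n nQ)) => /=; rewrite nP.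
    exact: (absorbs_P c).1.
  have [[m mQ]|noQ] := pselect (exists m, isQ m); first by apply: sumAB mQ _; left.
  constructor 1; apply: iso_trans (sum_isoC _ _) _.
  apply: iso_trans (sum_iso BPc (iso_refl _)) _.
  by apply: absorbs_dsum0 => -[m mQ]; apply: noQ; exists m.
have tlt n : ~~ isQ n -> (t n).2 < c.
  move=> nQ; rewrite lt_neqAle tc andbT; apply/eqP => tnc.
  have E : t n = ((t n).1, c) by rewrite -tnc -surjective_pairing.
  move: nQ; rewrite /isQ; case E1 : (t n).1 E => ->; last by rewrite eqxx.
  by case: noP; exists n; rewrite [LHS]surjective_pairing E1 tnc.
(* Some rank reaches [c], and without [P c] the term there must be [Q c]. *)
have [n nQ] : exists n, isQ n.
  have [n cn] := cof c ca; exists n; apply: contraT => /tlt.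
  by rewrite ltNge cn.
have [[m mQ]|noB] := pselect (exists m, ~~ isQ m).
  apply: sumAB nQ _.
  by apply: IH => //; [constructor; exists m|move=> k; exact: tlt (valP k)].
constructor 2; apply: iso_trans (iso_trans AQ
  (Q_finite_dsum c (exist _ n nQ) finQ)).
by apply: absorbs_dsum0 => -[m mQ]; apply: noB; exists m.
Qed.

(** * Normal forms for the class [inB] *)

(** Otherwise the closed initial segments up to the [r n] would cover [W] by countably many
    countable sets. The boolean separates [r n] from the elements below it. *)
Lemma bounded_ranks (N : countType) (r : N -> W) : exists a, forall n, r n < a.
Proof.
apply/not_existsP => noa; case: hW => _ countW; apply.
apply: (@sub_countable _ _ _ (\bigcup_(p in [set: N * bool])
    if p.2 then [set r p.1] else [set b | b < r p.1])).
  apply: subset_card_le => a _; have /existsNP[n /negP] := noa a.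
  rewrite -leNgt le_eqVlt => /predU1P[->|ar]; first by exists (n, true).
  by exists (n, false).
apply: bigcup_countable => // -[n []] _ /=; first exact: countable1.
exact: countW.
Qed.

(** [P a] and [Q a] absorb themselves, so they too can be written with exactly two terms, giving one
    index type for all three forms. *)
Lemma normal_form_terms (a : W) (I : ideal nat) : normal_form a I ->
  exists t : bool -> bool * W, I ≅ dsum (fun b => term (t b)).
Proof.
have t2 (s1 s2 : bool) (e : I ≅ term (s1, a) ⊞ term (s2, a)) :
    exists t : bool -> bool * W, I ≅ dsum (fun b => term (t b)).
  exists (fun b => (if b then s1 else s2, a)); apply: iso_trans e _.
  exact: iso_sym (dsum_bool _).
case=> e; [apply: (t2 true true)|apply: (t2 false false)|exact: (t2 true false)].
  by apply: iso_trans e (iso_sym _); apply: (absorbs_P a).1.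
by apply: iso_trans e (iso_sym _); exact: absorbs_Q_Q.
Qed.

Lemma normal_form_iso (a : W) (X Y : countType) (I : ideal X) (J : ideal Y) :
  I ≅ J -> normal_form a I -> normal_form a J.
Proof.
move=> /iso_sym IJ [] e; [constructor 1|constructor 2|constructor 3];
  exact: iso_trans e.
Qed.

Lemma normal_form_orthogonal (a : W) (X : countType) (I : ideal X) :
  normal_form a I -> normal_form a I^⊥.
Proof.
case=> /iso_orthogonal e.
- by constructor 2.
- by constructor 1; apply: iso_trans e (Q_orthogonal a).
- constructor 3; apply: iso_trans e _; apply: iso_trans (sum_orthogonal _ _) _.
  apply: iso_trans (sum_isoC _ _) _.
  exact: sum_iso (Q_orthogonal a) (iso_refl _).
Qed.

(** Splitting each summand into two terms flattens the sum to one of terms indexed by pairs, whose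
    ranks have a common strict bound. *)
Lemma dsum_normal_form (N : countType) (I : N -> ideal nat) :
  inhabited N -> (forall n, exists a, normal_form a (I n)) ->
  exists a, normal_form a (dsum I).
Proof.
move=> [n0] /= nfI.
have /choice[t It] n : exists t : bool -> bool * W,
    I n ≅ dsum (fun b => term (t b)).
  by have [a /normal_form_terms] := nfI n.
pose T (p : {_ : N & bool}) := t (tag p) (tagged p).
have [a Ta] := bounded_ranks (fun p => (T p).2).
have e : dsum (fun p => term (T p)) ≅ dsum I.
  apply: iso_sym; apply: iso_trans (dsum_iso It) _; exact: dsum_dsum.
have [||eP|[b _ Ib]] := @dsum_normal_upto a _ T.
- by constructor; exact: (existT _ n0 true).
- exact: Ta.
- by exists a; apply: normal_form_iso e _; constructor 1.
- by exists b; exact: normal_form_iso Ib.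
Qed.

Lemma inB_normal_form (I : ideal nat) : inB I -> exists a, normal_form a I.
Proof.
elim=> {I} [|I J IJ _ [a Ia]|I _ [a Ia]|N I J _ IH JI].
- have [a a0] := exists_zero.
  exists a; constructor 2; rewrite /Q (P_zero hW v a0).
  exact: iso_sym (iso_orthogonal_powerset _).
- by exists a; exact: normal_form_iso Ia.
- by exists a; exact: normal_form_orthogonal.
(* The block containing the image of 0 shows that [N] is inhabited. *)
- have [f [g [fK _ _]]] := iso_preimage JI.
  have [|a Ia] := dsum_normal_form _ IH; first by constructor; exact: tag (f 0%N).
  by exists a; exact: normal_form_iso (iso_sym JI) Ia.
Qed.

End Hierarchy.

Theorem theorem3p2 (d : Order.disp_t) (W : orderType d) (hW : is_omega1 W)
    (v : W -> nat -> W) (hv : fundamental_sequences v) (I : ideal nat)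
    (hI : inB I) :
  exists a : W, I ≅ P hW v a \/ I ≅ Q hW v a \/ I ≅ (P hW v a ⊕ Q hW v a).
Proof.
have [a [e|e|e]] := inB_normal_form hW hv hI; exists a; [by left|by right; left|].
by right; right; apply: iso_trans e (iso_sym (dsum2_iso _ _)).
Qed.
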